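(* The approximation ratio of RepeatedGreedy for the problem of maximizing a non-negative submodular function subject to a $k$-extendible system constraint is $k+\Omega(\sqrt{k})$, regardless of the number $\ell$ of iterations used by the algorithm. That is, there is a constant $c>0$ such that for infinitely many $k$ (namely all $k$ with $\sqrt{k}$ an integer) there is an instance with a $k$-extendible constraint and a non-negative submodular objective on which, for every $\ell\ge1$, the output $S$ of RepeatedGreedy satisfies $f(OPT)/f(S)\ge k+c\sqrt{k}$.
   Context: $f$ submodular: $f(X\cup Y)+f(X\cap Y)\le f(X)+f(Y)$; $f(u\mid S)=f(S\cup\{u\})-f(S)$; $S+u=S\cup\{u\}$. Independence system: non-empty down-closed $\mathcal{I}\subseteq2^{\mathcal{N}}$; $k$-extendible: for all $A\subseteq B\in\mathcal{I}$ and $u\notin B$ with $A+u\in\mathcal{I}$ there is $Y\subseteq B\setminus A$, $|Y|\le k$, with $(B\setminus Y)\cup\{u\}\in\mathcal{I}$. $OPT$ maximizes $f$ over $\mathcal{I}$. Greedy$(\mathcal{N}',f,\mathcal{I})$: $S=\varnothing$; while some $u\in\mathcal{N}'\setminus S$ has $S+u\in\mathcal{I}$ and $f(u\mid S)>0$, add such $u$ maximizing $f(u\mid S)$; return $S$. USM$(A,f)$ is any subroutine returning a subset of $A$ (intended as an approximate unconstrained maximizer of $f$ over subsets of $A$). RepeatedGreedy$(\mathcal{N},f,\mathcal{I},\ell)$: $\mathcal{N}_1=\mathcal{N}$; for $i=1,\dots,\ell$: $S_i=$Greedy$(\mathcal{N}_i,f,\mathcal{I})$, $S_i'=$USM$(S_i,f)$,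 $\mathcal{N}_{i+1}=\mathcal{N}_i\setminus S_i$. Return the set maximizing $f$ among $S_1,S_1',\dots,S_\ell,S_\ell'$. *)

(* Defs.v *)
From HB Require Import structures.
From mathcomp Require Import all_boot all_order all_algebra.
From mathcomp Require Import reals.

Set Implicit Arguments.
Unset Strict Implicit.
Unset Printing Implicit Defensive.

Import Order.TTheory GRing.Theory Num.Theory.
Local Open Scope ring_scope.

Section Defs.
Variables (R : realType) (T : finType).
Implicit Types (f : {set T} -> R) (I : {set {set T}}).
Implicit Types (A B N S X Y O : {set T}) (u v : T).

Definition nonnegative f := forall X, 0 <= f X.

Definition submodular f :=
  forall X Y, f (X :|: Y) + f (X :&: Y) <= f X + f Y.

(* f(u | S) *)
Definition marginal f u S : R := f (S :|: [set u]) - f S.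

Definition independence_system I :=
  I != set0 /\ forall A B, A \subset B -> B \in I -> A \in I.

Definition k_extendible (k : nat) I :=
  forall A B u, A \subset B -> B \in I -> u \notin B -> A :|: [set u] \in I ->
    exists Y, [/\ Y \subset B :\: A, (#|Y| <= k)%N
                & (B :\: Y) :|: [set u] \in I].

Definition is_opt f I O := O \in I /\ forall X, X \in I -> f X <= f O.

Definition candidate N f I S u :=
  [/\ u \in N :\: S, S :|: [set u] \in I & 0 < marginal f u S].

(* Ties are broken arbitrarily, so the greedy algorithm is a relation:
   [greedy_from N f I S S'] says that, started from the current set S, the
   while loop can terminate with S'. *)
Inductive greedy_from N f I : {set T} -> {set T} -> Prop :=
| greedy_stop S :
    (forall u, ~ candidate N f I S u) -> greedy_from N f I S S
| greedy_step S S' u :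
    candidate N f I S u ->
    (forall v, candidate N f I S v -> marginal f v S <= marginal f u S) ->
    greedy_from N f I (S :|: [set u]) S' ->
    greedy_from N f I S S'.

Definition greedy N f I S := greedy_from N f I set0 S.

(* A possibly randomized subroutine: [usm A f B] says that B is a possible
   answer on input (A, f). *)
Definition subroutine := {set T} -> ({set T} -> R) -> {set T} -> Prop.

Definition is_usm (usm : subroutine) :=
  forall A f B, usm A f B -> B \subset A.

(* [N_ i], [S_ i], [S'_ i] are only constrained at the indices used by the
   algorithm, 1 <= i <= l (and l + 1 for [N_]). *)
Definition repeated_greedy (usm : subroutine) N f I (l : nat) S :=
  exists N_ S_ S'_ : nat -> {set T},
    [/\ N_ 1 = N,
        forall i, (1 <= i <= l)%N ->
          [/\ greedy (N_ i) f I (S_ i), usm (S_ i) f (S'_ i)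
            & N_ i.+1 = N_ i :\: S_ i],
        exists i, (1 <= i <= l)%N /\ (S = S_ i \/ S = S'_ i)
      & forall i, (1 <= i <= l)%N -> f (S_ i) <= f S /\ f (S'_ i) <= f S].

End Defs.

(* Main.v *)
Require Import Defs.
From HB Require Import structures.
From mathcomp Require Import all_boot all_order all_algebra.
From mathcomp Require Import reals.
From mathcomp Require Import zify lra.

Set Implicit Arguments.
Unset Strict Implicit.
Unset Printing Implicit Defensive.

Import Order.TTheory GRing.Theory Num.Theory.
Local Open Scope ring_scope.

(** Write [k = n ^ 2]. The optimum is a set of [k + n] good elements, indexed by
   [n] rows of [n + 1] slots, each contributing [worth]. Every good element has
   a decoy contributing slightly more, next to which it adds only [1]. Decoys
   exclude each other and each is compatible with [n + 1] good elements, so an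
   exchange discards at most [k - 1] good elements and one decoy. The decoy of a
   leading slot [(i, None)] is compatible with its row, but spoils the other
   slots of the row; it takes all [n] rows to destroy the optimum in this way,
   which is why the objective can be non-negative. The decoy of another slot is
   compatible with the leading slots, which have been used up by the time such a
   decoy is chosen. So each run of greedy returns a single decoy with its good
   element, of value at most [worth + 3], and removes both: the ratio is at
   least [(k + n) * worth / (worth + 3)]. *)

Section Greedy.
Variables (R : realType) (T : finType) (f : {set T} -> R) (I : {set {set T}}).
Implicit Types (N S : {set T}) (u w : T).

Lemma greedy_from_no_candidate N S S' :
  greedy_from N f I S S' -> forall u, ~ candidate N f I S' u.
Proof. by elim. Qed.

Lemma greedy_from_invariant N (P : {set T} -> Prop) S S' :
    (forall X u, P X -> candidate N f I X u -> P (X :|: [set u])) ->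
  greedy_from N f I S S' -> P S -> P S'.
Proof.
by move=> Pstep; elim=> // {}S {}S' u cand_u _ _ IH PS; apply/IH/Pstep.
Qed.

Definition greedy_choice N S u :=
  candidate N f I S u /\
  forall w, candidate N f I S w -> marginal f w S <= marginal f u S.

Lemma greedy_first_choice N S : greedy N f I S ->
  S = set0 \/
  exists2 u, greedy_choice N set0 u & greedy_from N f I [set u] S.
Proof.
rewrite /greedy; move Z0: {1}set0 => Z run.
case: Z S / run Z0 => [Z _ <-|Z S u cand_u max_u run Z0]; first by left.
by right; exists u; rewrite -Z0 in cand_u max_u run *; rewrite ?set0U in run.
Qed.

Variable usm : subroutine R T.

Lemma repeated_greedy_subset (P : {set T} -> Prop) N l S :
    is_usm usm ->
    (forall N' S', P N' -> greedy N' f I S' -> P (N' :\: S')) -> P N ->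
    repeated_greedy usm N f I l S ->
  exists N' S', [/\ P N', greedy N' f I S' & S \subset S'].
Proof.
move=> usm_sub Pgreedy PN [N_ [S_ [S'_ [N1 run [j [jl Sj]] _]]]].
have PN_ i : (1 <= i <= l)%N -> P (N_ i).
  elim: i => // -[_ _|i IH il]; first by rewrite N1.
  have il' : (1 <= i.+1 <= l)%N by lia.
  by have [greedy_i _ ->] := run _ il'; apply: Pgreedy greedy_i; apply: IH.
have [greedy_j usm_j _] := run _ jl.
exists (N_ j), (S_ j); split=> //; first exact: PN_.
by case: Sj => -> //; apply: usm_sub usm_j.
Qed.

Lemma repeated_greedy_ge_greedy N l S :
    (1 <= l)%N -> repeated_greedy usm N f I l S ->
  exists2 S', greedy N f I S' & f S' <= f S.
Proof.
move=> l1 [N_ [S_ [S'_ [<- run _ best]]]].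
have first_run : (1 <= 1 <= l)%N by [].
by exists (S_ 1%N); [have [] := run _ first_run|have [] := best _ first_run].
Qed.

End Greedy.

Lemma submodular_sum (R : realType) (T J : finType) (f : J -> {set T} -> R) :
  (forall j, submodular (f j)) -> submodular (fun X => \sum_j f j X).
Proof.
by move=> f_sub X Y; rewrite -!big_split; apply: ler_sum => j _; apply: f_sub.
Qed.

Section Cliques.
Variables (T : finType) (r : rel T).

Definition cliques : {set {set T}} :=
  [set X : {set T} | [forall x in X, forall y in X, r x y]].

Lemma cliquesP (X : {set T}) :
  reflect {in X &, forall x y, r x y} (X \in cliques).
Proof.
rewrite inE; apply: (iffP forall_inP) => rX x => [y xX|xX].
  exact/forall_inP/rX.
by apply/forall_inP => y; apply: rX.
Qed.

Lemma independence_system_cliques : independence_system cliques.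
Proof.
split; first by apply/set0Pn; exists set0; apply/cliquesP => x y; rewrite inE.
move=> A B /subsetP sAB /cliquesP rB; apply/cliquesP => x y /sAB xB /sAB yB.
exact: rB.
Qed.

Lemma k_extendible_cliques (k : nat) : reflexive r -> symmetric r ->
    (forall B u, B \in cliques -> #|[set y in B | ~~ r y u]| <= k)%N ->
  k_extendible k cliques.
Proof.
move=> r_refl r_sym conflicts_le A B u sAB cliqueB _ /cliquesP rAu.
exists [set y in B | ~~ r y u]; split; last 1 first.
- have r_u x : x \in B :\: [set y in B | ~~ r y u] -> r x u.
    by rewrite !inE => /andP[+ xB]; rewrite xB negbK.
  apply/cliquesP => x y; rewrite 2!in_setU !in_set1.
  move=> /orP[xB|/eqP->] /orP[yB|/eqP->] //; last 2 first.
  + exact: r_u.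
  + by rewrite r_sym r_u.
  case/setDP: xB => xB _; case/setDP: yB => yB _.
  exact: (cliquesP _ cliqueB).
- apply/subsetP => y; rewrite !inE => /andP[yB]; rewrite yB andbT.
  by apply: contra => yA; apply: rAu; rewrite !inE ?yA ?eqxx ?orbT.
- exact: conflicts_le.
Qed.

End Cliques.

Section Instance.
Variables (R : realType) (n worth : nat).

Definition slot : finType := ('I_n * option 'I_n)%type.
Definition elt : finType := (slot * bool)%type.

Local Notation good s := (s, false).
Local Notation decoy s := (s, true).

Implicit Types (s t : slot) (x y u w : elt) (N S X Y : {set elt}).

Definition leading s := s.2 == None.

Definition leader s : slot := (s.1, None).

Definition decoy_fits s t :=
  if leading s then t.1 == s.1 else leading t || (t == s).

Definition compatible x y :=
  match x, y with
  | decoy s, decoy t => s == t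
  | decoy s, good t | good t, decoy s => decoy_fits s t
  | good _, good _ => true
  end.

Local Notation feasible := (cliques compatible).

Definition slot_pair s : {set elt} := [set good s; decoy s].

Definition pair_value s (has_good has_decoy : bool) : nat :=
  if has_decoy then (worth + (leading s).+1 + has_good)%N
  else (has_good * worth)%N.

Definition spoiled s X := ~~ leading s && (decoy (leader s) \in X).

Definition slot_value s X : nat :=
  if spoiled s X then 0%N else pair_value s (good s \in X) (decoy s \in X).

Definition objective X : R := \sum_s (slot_value s X)%:R.

Lemma decoy_fits_refl s : decoy_fits s s.
Proof. by rewrite /decoy_fits !eqxx orbT if_same. Qed.

Lemma compatible_refl : reflexive compatible.
Proof. by case=> s []; rewrite /= ?eqxx. Qed.

Lemma compatible_sym : symmetric compatible.
Proof. by case=> s [] [t []] //=; rewrite eq_sym. Qed.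

Lemma card_slot : #|{: slot}| = (n * n.+1)%N.
Proof. by rewrite card_prod card_option card_ord. Qed.

Lemma card_decoy_fits s : #|[set t | decoy_fits s t]| = n.+1.
Proof.
case: s => i [j|].
  have -> : [set t | decoy_fits (i, Some j) t] =
            (i, Some j) |: setX [set: 'I_n] [set None].
    by apply/setP => t; rewrite !inE orbC.
  by rewrite cardsU1 !inE cardsX cardsT cards1 card_ord muln1.
have -> : [set t | decoy_fits (i, None) t] = setX [set i] [set: option 'I_n].
  by apply/setP => t; rewrite !inE andbT.
by rewrite cardsX cards1 cardsT card_option card_ord mul1n.
Qed.

Definition goods : {set elt} := [set x | ~~ x.2].

Lemma goods_feasible : goods \in feasible.
Proof. by apply/cliquesP => -[s []] [t []]; rewrite !inE. Qed.

Lemma slot_pair_feasible s : slot_pair s \in feasible.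
Proof.
apply/cliquesP => x y /set2P[]-> /set2P[]-> //=; exact: decoy_fits_refl.
Qed.

Lemma card_feasible_decoys X : X \in feasible -> (#|X :\: goods| <= 1)%N.
Proof.
move=> /cliquesP cX; apply/card_le1_eqP => -[s []] [t []]; rewrite !inE //=.
by move=> sX tX; have /= /eqP-> := cX _ _ sX tX.
Qed.

Lemma card_conflicting_goods u :
  (#|[set y in goods | ~~ compatible y u]| < n ^ 2)%N.
Proof.
have n_gt0 : (0 < n)%N by case: u.1.1 => m; apply: leq_ltn_trans.
case: u => s [].
  have -> : [set y in goods | ~~ compatible y (decoy s)] =
            setX (~: [set t | decoy_fits s t]) [set false].
    by apply/setP => -[t []]; rewrite !inE ?andbF ?andbT.
  rewrite cardsX cards1 cardsCs setCK card_slot card_decoy_fits; nia.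
have -> : [set y in goods | ~~ compatible y (good s)] = set0.
  by apply/setP => -[t []]; rewrite !inE.
by rewrite cards0 expn_gt0 n_gt0.
Qed.

Lemma k_extendible_feasible : k_extendible (n ^ 2) feasible.
Proof.
apply: k_extendible_cliques compatible_refl compatible_sym _ => B u feasB.
set conflicts := [set y in B | _].
have conflictsB : conflicts \subset B by apply/subsetP => y /setIdP[].
have few_decoys : (#|conflicts :\: goods| <= 1)%N.
  apply: leq_trans (card_feasible_decoys feasB).
  exact/subset_leq_card/setSD.
have few_goods : (#|conflicts :&: goods| < n ^ 2)%N.
  apply: leq_ltn_trans (card_conflicting_goods u); apply/subset_leq_card.
  by apply/subsetP => y; rewrite !inE => /andP[/andP[_ ->] ->].
by rewrite -(cardsID goods); lia.
Qed.

Lemma nonnegative_objective : nonnegative objective.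
Proof. by move=> X; apply: sumr_ge0. Qed.

Lemma submodular_objective : (0 < worth)%N -> submodular objective.
Proof.
move=> worth_gt0; apply: submodular_sum => s X Y; rewrite -!natrD ler_nat.
rewrite /slot_value /spoiled /pair_value !inE.
case: (leading s) => /=; case: (decoy (leader s) \in X);
case: (decoy (leader s) \in Y); case: (decoy s \in X);
case: (decoy s \in Y); case: (good s \in X); case: (good s \in Y) => /=; lia.
Qed.

Lemma objective_goods : objective goods = (n * n.+1 * worth)%:R.
Proof.
rewrite /objective -natr_sum -card_slot -sum_nat_const; congr _%:R.
apply: eq_bigr => s _.
by rewrite /slot_value /spoiled /pair_value !inE andbF mul1n.
Qed.

Lemma pair_not_spoiled s X : X \subset slot_pair s -> spoiled s X = false.
Proof.
move=> /subsetP sX; apply/negP => /andP[not_leading /sX].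
rewrite !inE !xpair_eqE andbF andbT => /eqP leader_s.
by rewrite -leader_s /leading eqxx in not_leading.
Qed.

Lemma spoiled_same_row s t X :
  leading s -> t.1 == s.1 -> t != s -> decoy s \in X -> spoiled t X.
Proof.
case: s t => i a [j b] /eqP /= -> /eqP->.
rewrite xpair_eqE eqxx /= => not_lead sX.
by rewrite /spoiled /leading not_lead.
Qed.

Lemma objective_pair s X : X \subset slot_pair s ->
  objective X = (pair_value s (good s \in X) (decoy s \in X))%:R.
Proof.
move=> X_pair.
rewrite /objective (bigD1 s) //= {1}/slot_value pair_not_spoiled //.
rewrite big1 ?addr0 // => t ts.
have outside b : (t, b) \in X = false.
  apply/negP => /(subsetP X_pair).
  by rewrite !inE !xpair_eqE (negbTE ts).
by rewrite /slot_value /pair_value !outside if_same.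
Qed.

Lemma sub1_pair s b : [set (s, b)] \subset slot_pair s.
Proof. by rewrite sub1set !inE; case: b; rewrite eqxx ?orbT. Qed.

Lemma objective_set0 : objective set0 = 0.
Proof.
rewrite /objective big1 // => s _.
by rewrite /slot_value /pair_value !inE if_same.
Qed.

Lemma marginal_set0 s b :
  marginal objective (s, b) set0 = (pair_value s (~~ b) b)%:R.
Proof.
rewrite /marginal set0U objective_set0 subr0 (objective_pair (sub1_pair s b)).
by rewrite !inE !xpair_eqE eqxx; case: b.
Qed.

Lemma marginal_spoiled s S :
  spoiled s S -> marginal objective (good s) S = 0.
Proof.
move=> s_spoiled; apply/eqP; rewrite subr_eq0; apply/eqP/eq_bigr => t _.
have spoiled_add : spoiled t (S :|: [set good s]) = spoiled t S.
  by rewrite /spoiled !inE !xpair_eqE andbF orbF.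
rewrite /slot_value spoiled_add.
have [->|ts] := eqVneq t s; first by rewrite s_spoiled.
by rewrite !inE !xpair_eqE (negbTE ts) !orbF.
Qed.

Lemma candidate_decoy N s :
  decoy s \in N -> candidate N objective feasible set0 (decoy s).
Proof.
move=> sN; split; first by rewrite !inE.
  rewrite set0U; apply: (independence_system_cliques _).2 (sub1_pair s true) _.
  exact: slot_pair_feasible.
by rewrite marginal_set0 ltr0n /pair_value; lia.
Qed.

Lemma candidate_good N S s :
    decoy s \in S -> S \subset slot_pair s -> good s \in N -> good s \notin S ->
  candidate N objective feasible S (good s).
Proof.
move=> sS S_pair sN not_sS.
have S'_pair : S :|: [set good s] \subset slot_pair s.
  by rewrite subUset S_pair sub1_pair.
split; first by rewrite inE not_sS.
  exact: (independence_system_cliques _).2 (slot_pair_feasible s).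
rewrite subr_gt0 !(objective_pair (s := s)) // ltr_nat !inE sS eqxx.
by rewrite (negbTE not_sS) /pair_value /= addn0 addn1.
Qed.

(* Greedy prefers the decoys of leading slots: it picks another decoy only when
   these are exhausted, together with their good elements. *)
Definition eligible N s :=
  ~~ leading s -> forall t, leading t -> good t \notin N.

Lemma candidate_eq_good N S s u :
    eligible N s -> decoy s \in S -> S \subset slot_pair s ->
  candidate N objective feasible S u -> u = good s.
Proof.
move=> s_eligible sS S_pair [/setDP[uN uS] /cliquesP cliqueSu marginal_u].
have := cliqueSu (decoy s) u; rewrite !inE sS eqxx orbT => /(_ isT isT).
case: u uN uS marginal_u {cliqueSu} => t [] tN tS marginal_t /=.
  by move=> /eqP st; rewrite -st sS in tS.
have [-> //|ts] := eqVneq t s.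
rewrite /decoy_fits (negbTE ts) orbF; case: ifP => s_lead.
  move=> same_row; have t_spoiled := spoiled_same_row s_lead same_row ts sS.
  by rewrite marginal_spoiled ?ltxx in marginal_t.
by move=> t_lead; have := s_eligible (negbT s_lead) t t_lead; rewrite tN.
Qed.

Definition decoy_closed N := forall s, good s \in N -> decoy s \in N.

Lemma greedy_choice_decoy N u :
    decoy_closed N -> greedy_choice objective feasible N set0 u ->
  exists2 s, u = decoy s & eligible N s.
Proof.
move=> N_closed [[/setDP[uN _] _ _] u_max].
have decoy_le t : decoy t \in N ->
    (pair_value t false true <= pair_value u.1 (~~ u.2) u.2)%N.
  move=> /candidate_decoy/u_max; rewrite [u]surjective_pairing.
  by rewrite !marginal_set0 ler_nat.
case: u uN decoy_le {u_max} => s [] sN decoy_le.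
  exists s => // not_lead t t_lead; apply/negP => /N_closed/decoy_le.
  by rewrite /pair_value t_lead (negbTE not_lead) /=; lia.
by have := decoy_le _ (N_closed _ sN); rewrite /pair_value /=; lia.
Qed.

Lemma greedy_slot_pair N S :
    decoy_closed N -> greedy N objective feasible S ->
  S = set0 \/
  exists s, [/\ decoy s \in S, S \subset slot_pair s
              & good s \in N -> good s \in S].
Proof.
move=> N_closed /greedy_first_choice[->|[u u_choice run]]; [by left|right].
have [s u_s s_eligible] := greedy_choice_decoy N_closed u_choice.
rewrite {}u_s in run.
pose inside_pair X := decoy s \in X /\ X \subset slot_pair s.
have [sS S_pair] : inside_pair S.
  apply: greedy_from_invariant run _; last by split; rewrite ?set11 ?sub1_pair.
  move=> X w [sX X_pair] /(candidate_eq_good s_eligible sX X_pair) ->.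
  by split; rewrite ?subUset ?X_pair ?sub1_pair // inE sX.
exists s; split=> // sN; apply: contraT => not_sS.
by case: (greedy_from_no_candidate run (candidate_good sS S_pair sN not_sS)).
Qed.

Lemma decoy_closed_setD N S :
  decoy_closed N -> greedy N objective feasible S -> decoy_closed (N :\: S).
Proof.
move=> N_closed /(greedy_slot_pair N_closed)[->|[s [_ S_pair goodS]]] t.
  by rewrite setD0; apply: N_closed.
rewrite !inE => /andP[not_tS tN]; rewrite N_closed // andbT.
apply: contra not_tS => /(subsetP S_pair); rewrite !inE !xpair_eqE andbF andbT.
by move=> /eqP ts; rewrite ts in tN *; apply: goodS.
Qed.

Lemma objective_subset_greedy_le N S X :
    decoy_closed N -> greedy N objective feasible S ->
  X \subset S -> objective X <= (worth + 3)%:R.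
Proof.
move=> N_closed /(greedy_slot_pair N_closed)[->|[s [_ S_pair _]]] XS.
  by move: XS; rewrite subset0 => /eqP->; rewrite objective_set0.
rewrite (objective_pair (subset_trans XS S_pair)) ler_nat /pair_value.
by case: (leading s); do 2!case: (_ \in X); lia.
Qed.

Lemma objective_greedy_gt0 N S s :
    decoy_closed N -> decoy s \in N ->
  greedy N objective feasible S -> 0 < objective S.
Proof.
move=> N_closed sN run.
have [S0|[t [tS S_pair _]]] := greedy_slot_pair N_closed run.
  rewrite S0 in run.
  by case: (greedy_from_no_candidate run (candidate_decoy sN)).
by rewrite (objective_pair S_pair) tS ltr0n /pair_value; lia.
Qed.

Lemma repeated_greedy_ratio (usm : subroutine R elt) l OPT S :
    is_usm usm -> (1 <= l)%N -> is_opt objective feasible OPT ->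
    repeated_greedy usm [set: elt] objective feasible l S ->
  (n * n.+1 * worth)%:R / (worth + 3)%:R <= objective OPT / objective S.
Proof.
move=> usm_sub l1 [_ opt] run.
have goods_le := opt _ goods_feasible; rewrite objective_goods in goods_le.
have [n0|n_gt0] := posnP n.
  rewrite {1}n0 !mul0n mul0r; apply: divr_ge0; exact: nonnegative_objective.
have setT_closed : decoy_closed [set: elt] by move=> s _; rewrite inE.
have S_gt0 : 0 < objective S.
  have [S' run' le_S] := repeated_greedy_ge_greedy l1 run.
  apply: lt_le_trans le_S.
  apply: (objective_greedy_gt0 (s := (Ordinal n_gt0, None)) _ _ run') => //.
  by rewrite inE.
have S_le : objective S <= (worth + 3)%:R.
  have [N' [S' [N'_closed run' SS']]] :=
    repeated_greedy_subset usm_sub decoy_closed_setD setT_closed run.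
  exact: objective_subset_greedy_le run' SS'.
apply: ler_pM => //; first by rewrite invr_ge0.
by rewrite lef_pV2 // posrE ltr0n addn3.
Qed.

End Instance.

Lemma sqrt_natr_int (R : realType) (k : nat) :
  Num.sqrt (k%:R : R) \is a Num.int -> exists n, k = (n ^ 2)%N.
Proof.
move=> int_sqrt; have /natrP[n sqrt_k] : Num.sqrt (k%:R : R) \is a Num.nat.
  by rewrite natrEint int_sqrt sqrtr_ge0.
by exists n; apply/eqP; rewrite -(eqr_nat R) natrX -sqrt_k sqr_sqrtr.
Qed.

Theorem theorem32 (R : realType) :
  exists c : R, 0 < c /\
    forall k : nat, Num.sqrt (k%:R : R) \is a Num.int ->
      exists (T : finType) (f : {set T} -> R) (I : {set {set T}}),
        [/\ nonnegative f, submodular f, independence_system I,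
            k_extendible k I
          & forall (usm : subroutine R T) (l : nat) (OPT S : {set T}),
              is_usm usm -> (1 <= l)%N -> is_opt f I OPT ->
              repeated_greedy usm [set: T] f I l S ->
              k%:R + c * Num.sqrt k%:R <= f OPT / f S].
Proof.
exists 2^-1; split=> [|k /sqrt_natr_int[n ->]]; first by rewrite invr_gt0.
exists (elt n), (@objective R n (6 * n + 3)), (cliques (@compatible n)); split.
- exact: nonnegative_objective.
- by apply: submodular_objective; rewrite addn3.
- exact: independence_system_cliques.
- exact: k_extendible_feasible.
move=> usm l OPT S usm_sub l1 opt run.
apply: le_trans (repeated_greedy_ratio usm_sub l1 opt run).
(* [worth = 6 n + 3] makes this an equality. *)
rewrite natrX sqrtr_sqr ger0_norm // ler_pdivlMr ?ltr0n; last by rewrite addn3.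
by rewrite -[n.+1]addn1 !(natrM, natrD); lra.
Qed.
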